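(* Let $\mathcal{X}=\{x_1,\dots,x_m\}$ be a finite alphabet and let $p\in\mathcal{P}(\mathcal{X})$. For each $n$ let $\nu^n$ be an $n$-type, and suppose $\nu^n\to p$ in total variation. Let $\mathcal{Q}\subseteq\mathcal{P}(\mathcal{X})$ be a convex, closed, rare set of sources, where rare means $p\notin\mathcal{Q}$. Let $\hat q$ be the $L$-projection of $p$ on $\mathcal{Q}$, and let $B(\hat q,\epsilon)$ be the closed $\epsilon$-ball in the total variation metric centered at $\hat q$. Assume the uniform prior on $n$-sources for each $n$. Then, for every $\epsilon>0$, $$\lim_{n\to\infty}\pi\big(q^n\in B(\hat q,\epsilon)\mid(q^n\in\mathcal{Q})\wedge\nu^n\big)=1.$$
   Context: $\mathcal{P}(\mathcal{X})$ is the set of all probability mass functions (pmf's) on $\mathcal{X}$, with the topology induced from $\mathbb{R}^m$; its elements are called sources. $\mathcal{R}_n$ is the set of $n$-rational pmf's, i.e. those of the form $[n_1,\dots,n_m]/n$ with nonnegative integers $n_i$ summing to $n$. Elements of $\mathcal{R}_n$ are called $n$-types (when regarded as empirical measures of sequences of length $n$) or $n$-sources (when regarded as sources, written $q^n$). Uniform prior: $\pi(q^n)=1/N$ for all $q^n\in\mathcal{R}_n$, where $N=\binom{n+m-1}{m-1}=|\mathcal{R}_n|$. Likelihood: $\pi(\nu^n\mid q^n)=\Gamma(\nu^n)\prod_{i=1}^m(q^n_i)^{n\nu^n_i}$, with $\Gamma(\nu^n)=n!/\prod_{i=1}^m n_i!$ for $\nu^n=[n_1,\dots,n_m]/n$ (convention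 $0^0=1$). The posterior is given by Bayes' theorem: $\pi(q^n\mid\nu^n)=\pi(\nu^n\mid q^n)\pi(q^n)/\sum_{\tilde q\in\mathcal{R}_n}\pi(\nu^n\mid\tilde q)\pi(\tilde q)$, and $\pi(q^n\in C\mid\nu^n)=\sum_{q^n\in C\cap\mathcal{R}_n}\pi(q^n\mid\nu^n)$ for $C\subseteq\mathcal{P}(\mathcal{X})$. The conditional probability is $\pi(q^n\in B\mid(q^n\in\mathcal{Q})\wedge\nu^n)=\pi(q^n\in B\cap\mathcal{Q}\mid\nu^n)/\pi(q^n\in\mathcal{Q}\mid\nu^n)$, provided that $\pi(q^n\in\mathcal{Q}\mid\nu^n)>0$. For $p,q\in\mathcal{P}(\mathcal{X})$ the $L$-divergence is $L(q\|p)=\sum_{x\in\mathcal{X}}p(x)\log q(x)\in\mathbb{R}\cup\{-\infty\}$ (conventions $\log 0=-\infty$, $0\log 0=0$). The $L$-projection of $p$ on a set $\mathcal{C}$ of sources is $\hat q=\arg\sup_{q\in\mathcal{C}}L(q\|p)$.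
   Formalization: Added: q̂ is a limit of n-sources lying in Q (without this the claim fails, e.g. for Q in an irrational plane); the L-projection is taken to be the unique maximiser; the limit runs over those n for which the conditional probability is defined. *)

(* Defs.v *)
From HB Require Import structures.
From mathcomp Require Import all_boot all_order all_algebra.
From mathcomp Require Import all_classical all_reals all_analysis.

Set Implicit Arguments.
Unset Strict Implicit.
Unset Printing Implicit Defensive.

Import Order.TTheory GRing.Theory Num.Theory.
Import numFieldNormedType.Exports.

Local Open Scope classical_set_scope.
Local Open Scope ring_scope.

Section Sources.
Context {R : realType} {m : nat}.
Implicit Types (p q nu : 'rV[R]_m) (C D : set 'rV[R]_m) (n : nat).

(* A pmf on an alphabet of m letters is the row vector of its values, so that
   P(X) sits in R^m with its usual topology.  It is closed there, hence a
   subset of it is closed relatively to P(X) iff it is closed in R^m. *)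
Definition pmfs : set 'rV[R]_m :=
  [set q | (forall i, 0 <= q 0 i) /\ \sum_i q 0 i = 1].

(* For n = 0 this is empty: k i / 0 = 0, which does not sum to 1. *)
Definition nrational n : set 'rV[R]_m :=
  [set q | pmfs q /\ exists k : 'I_m -> nat,
     (\sum_i k i = n)%N /\ forall i, q 0 i = (k i)%:R / n%:R].

Definition tv p q : R := 2^-1 * \sum_i `|p 0 i - q 0 i|.

Definition tv_ball q (eps : R) : set 'rV[R]_m :=
  [set r | pmfs r /\ tv q r <= eps].

(* Truncation is exact for an n-type nu, where n * nu_i is an integer. *)
Definition count n nu (i : 'I_m) : nat := Num.truncn (n%:R * nu 0 i).

(* x ^+ 0 = 1 for all x, so that 0^0 = 1. *)
Definition likelihood n nu q : R :=
  n`!%:R / (\prod_i (count n nu i)`!)%:R * \prod_i q 0 i ^+ count n nu i.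

Definition prior n q : R := ('C(n + m - 1, m - 1))%:R^-1.

Definition posterior n nu q : R :=
  likelihood n nu q * prior n q /
  \sum_(r \in nrational n) (likelihood n nu r * prior n r).

Definition posterior_set n nu C : R :=
  \sum_(q \in C `&` nrational n) posterior n nu q.

(* Meaningful only when 0 < posterior_set n nu D; otherwise the quotient is 0
   by the convention x / 0 = 0. *)
Definition cond_posterior n nu C D : R :=
  posterior_set n nu (C `&` D) / posterior_set n nu D.

(* L(q || p); here lne 0 = -oo and 0 * -oo = 0 in \bar R. *)
Definition Ldiv q p : \bar R := (\sum_i (p 0 i)%:E * lne (q 0 i)%:E)%E.

Definition Lprojections p C : set 'rV[R]_m :=
  [set q | C q /\ Ldiv q p = ereal_sup [set Ldiv r p | r in C]].

End Sources.

(* Main.v *)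
Require Import Defs.
From HB Require Import structures.
From mathcomp Require Import all_boot all_order all_algebra.
From mathcomp Require Import all_classical all_reals all_analysis.
From mathcomp Require Import ring lra.

Set Implicit Arguments.
Unset Strict Implicit.

Import Order.TTheory GRing.Theory Num.Theory.
Import numFieldNormedType.Exports.

Local Open Scope classical_set_scope.
Local Open Scope ring_scope.

(** Write G_nu(q) for the product of the q_i ^ nu_i, that is exp L(q || nu).
For an n-type nu, the likelihood of an n-source q is a positive factor that
depends on nu only, times G_nu(q) ^ n ([likelihoodE]).  The posterior
probabilities of two n-sources thus compare like the n-th powers of their values
under G, while the number of n-sources is at most (n + 1) ^ m.  It is
therefore enough to find g3 < g2 such that, for n large, G is at most g3 on
the part of Q outside the ball and at least g2 at one n-source of Q: the
conditional probability of the complement of the ball is then at most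
(n + 1) ^ m (g3 / g2) ^ n ([cond_posterior_bounds]), which tends to 0.

Let g0 = G_p(qhat), the maximum of G_p over Q, attained at qhat only.
If g0 = 0, then Q is reduced to qhat.  Otherwise, by compactness, G_p is at
most some u < g0 on the points of Q at distance at least eps from qhat.

Upper bound ([Lexp_upper_rate]).  Since nu^n tends to p, for each th < 1 one
has nu^n >= th p coordinatewise for n large; as all q_i are at most 1, this gives
G_(nu^n)(q) <= G_p(q) ^ th uniformly in q, and th is chosen so that u ^ th = g3.

Lower bound ([Lexp_lower_rate]).  The point qhat need not be approached by
n-sources of Q for all n; only those n matter for which Q has an n-source of
positive posterior.  Here lies the arithmetic of the proof ([nrational_approx]).
Let t be a rational point of Q close to qhat.  Finitely many rational
points Y_j of Q span all the rational points of Q; let D be a common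
denominator.  An n-source s of Q can be moved by integer multiples of
(D / n) (Y_j - t) without ceasing to be n-rational, hence it can be moved to
within O(1/n) of any prescribed barycenter of t and the Y_j.  With a barycenter
that is close to t and gives a positive weight to all Y_j, the result is again a
barycenter, so it lies in Q, and it dominates coordinatewise a fixed vector
r >= (1 - b) t.  Each letter charged by some rational point of Q is charged by
r; the letters not charged by r are thus not charged by nu^n either when the
conditional is defined, so that G_(nu^n)(r) tends to G_p(r), although nu^n may
charge letters that p does not. *)

(** * Barycenters and spanning families *)

Section ConvexSets.
Context {R : realType} {V : lmodType R} (A : set V)
  (A_convex : convex_set (A : set (convex_lmodType V))).

Lemma convex_setP (x y : V) (l : R) :
  0 <= l <= 1 -> A x -> A y -> A (l *: x + (1 - l) *: y).
Proof.
move=> /andP[l0 l1] Ax Ay.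
have := @A_convex x y (Itv01 l0 l1).
by rewrite !inE => /(_ Ax Ay).
Qed.

(** The weights are normalized in the statement, so that they need not sum to 1
during the induction. *)
Lemma convex_set_barycenter (I : eqType) (s : seq I) (w : I -> R) (x : I -> V) :
  (forall i, 0 <= w i) -> (forall i, A (x i)) -> 0 < \sum_(i <- s) w i ->
  A ((\sum_(i <- s) w i)^-1 *: \sum_(i <- s) w i *: x i).
Proof.
move=> w_ge0 Ax; elim: s => [|i s IH]; first by rewrite big_nil ltxx.
rewrite !big_cons; set W := \sum_(j <- s) w j; set S := \sum_(j <- s) _.
have W_ge0 : 0 <= W by exact: sumr_ge0.
have [W0|W_neq0] := eqVneq W 0.
  have -> : S = 0.
    move/eqP: W0; rewrite psumr_eq0// => /allP w0.
    by rewrite /S big_seq big1// => j /w0/eqP ->; rewrite scale0r.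
  rewrite W0 !addr0 => wi_gt0.
  by rewrite scalerA mulVf ?scale1r// gt_eqF.
have W_gt0 : 0 < W by rewrite lt_def W_neq0.
move=> _.
have wW_gt0 : 0 < w i + W by rewrite ltr_wpDl.
have -> : (w i + W)^-1 *: (w i *: x i + S) =
  (w i / (w i + W)) *: x i + (1 - w i / (w i + W)) *: (W^-1 *: S).
  rewrite scalerDr !scalerA [_^-1 * _]mulrC; congr (_ + _ *: _).
  have h : w i + W != 0 by rewrite gt_eqF.
  by field; rewrite W_neq0.
apply: convex_setP; [|exact: Ax|exact: IH].
by rewrite divr_ge0 ?w_ge0 ?(ltW wW_gt0)//= ler_pdivrMr// mul1r lerDl.
Qed.

End ConvexSets.

(** A family of points of A whose span has maximal dimension will do. *)
Lemma exists_spanning_seq {K : fieldType} {V : vectType K} (A : set V) :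
  exists2 X : seq V, (forall x, x \in X -> A x) & forall v, A v -> v \in <<X>>%VS.
Proof.
pose P k := `[< exists2 X : seq V, (forall x, x \in X -> A x) & \dim <<X>> = k >].
have exP : exists k, P k by exists (\dim <<[::] : seq V>>); apply/asboolP; exists [::].
have ubP k : P k -> (k <= \dim {:V})%N.
  by move=> /asboolP[X _ <-]; rewrite dimvS// subvf.
have [k /asboolP[X XA dimX] kmax] := ex_maxnP exP ubP.
exists X => // v Av.
have sub : (<<X>> <= <<v :: X>>)%VS by rewrite span_cons addvSr.
have /kmax : P (\dim <<v :: X>>).
  by apply/asboolP; exists (v :: X) => // x; rewrite inE => /predU1P[->|/XA].
rewrite -dimX (geq_leqif (dimv_leqif_eq sub)) => /eqP ->.
by rewrite memv_span// mem_head.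
Qed.

(** * Rational points of a convex set of sources *)

Section RationalPoints.
Context {R : realType} {m : nat}.
Implicit Types (q s t : 'rV[R]_m) (Q : set 'rV[R]_m) (n : nat).

Lemma pmf_le1 q i : pmfs q -> q 0 i <= 1.
Proof.
by move=> [q0 <-]; rewrite (bigD1 i)//= lerDl sumr_ge0.
Qed.

Lemma nrational_gt0 n q : nrational n q -> (0 < n)%N.
Proof.
case: n => // -[[_ q1]] [k [_ kq]]; move: q1; rewrite big1.
  by move=> /esym/eqP; rewrite oner_eq0.
by move=> i _; rewrite kq invr0 mulr0.
Qed.

Lemma nrationalP n q :
  nrational n q <-> [/\ (0 < n)%N, pmfs q & forall i, n%:R * q 0 i \is a Num.nat].
Proof.
split=> [nq|[n0 pq nat_nq]].
  have n0 := nrational_gt0 nq; case: nq => pq [k [_ kq]]; split=> // i.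
  by rewrite kq mulrC divfK ?pnatr_eq0 -?lt0n// natr_nat.
have n0' : n%:R != 0 :> R by rewrite pnatr_eq0 -lt0n.
split=> //; exists (fun i => Num.truncn (n%:R * q 0 i)); split.
  apply/eqP; rewrite -(eqr_nat R) sum_truncnK//.
  by rewrite -mulr_sumr pq.2 mulr1.
by move=> i; rewrite truncnK// mulrC mulKf.
Qed.

Lemma common_denominator (Y : seq 'rV[R]_m) :
    (forall y, y \in Y -> (\bigcup_n nrational n) y) ->
  exists2 D, (0 < D)%N & forall y i, y \in Y -> D%:R * y 0 i \is a Num.nat.
Proof.
elim: Y => [|y Y IH] yY; first by exists 1%N.
have [D D0 DY] : exists2 D, (0 < D)%N &
    forall y i, y \in Y -> D%:R * y 0 i \is a Num.nat.
  by apply: IH => z zY; apply: yY; rewrite inE zY orbT.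
have [n _ /nrationalP[n0 _ ny]] := yY y (mem_head _ _).
exists (D * n)%N; first by rewrite muln_gt0 D0.
move=> z i; rewrite inE natrM => /predU1P[->|/DY zD].
  by rewrite -mulrA rpredM ?natr_nat.
by rewrite mulrAC rpredM ?natr_nat.
Qed.

(** Each D (Y_j - t) is an integer vector, so n q and n s differ by an integer
vector. *)
Lemma nrational_shift n (D k : nat) (Y : 'I_k -> 'rV[R]_m) (z : 'I_k -> int) s t q :
    nrational n s -> pmfs q ->
    (forall j i, D%:R * Y j 0 i \is a Num.nat) ->
    (forall i, D%:R * t 0 i \is a Num.nat) ->
    q = s + \sum_j ((z j)%:~R * (D%:R / n%:R)) *: (Y j - t) ->
  nrational n q.
Proof.
move=> /nrationalP[n0 _ ns] pq YD tD qE; apply/nrationalP; split=> // i.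
have q_ge0 := pq.1 i.
rewrite natrEint mulr_ge0 ?ler0n// andbT qE !mxE mulrDr rpredD//.
  by move: (ns i); rewrite natrEint => /andP[].
rewrite summxE mulr_sumr rpred_sum// => j _; rewrite !mxE.
have n0' : n%:R != 0 :> R by rewrite pnatr_eq0 -lt0n.
have -> : n%:R * ((z j)%:~R * (D%:R / n%:R) * (Y j 0 i - t 0 i)) =
    (z j)%:~R * (D%:R * Y j 0 i - D%:R * t 0 i) :> R by field.
rewrite rpredM ?intr_int// rpredB//.
  by move: (YD j i); rewrite natrEint => /andP[].
by move: (tD i); rewrite natrEint => /andP[].
Qed.

(** The vector r is (1 - b) t plus a uniform combination of the spanning points Y_j
of total weight b / 2; its mass is therefore 1 - b / 2.  The missing mass b / 2 is
what absorbs the rounding errors: the n-source q is built as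
(1 - W) t + sum_j (c0 + th_j) Y_j, where c0 is the weight of Y_j in r, the rounding
errors th_j lie in [0, D / n], and W <= b.  Such a q is a barycenter of points of Q and
dominates r coordinatewise. *)
Lemma nrational_approx Q t (b : R) :
    Q `<=` pmfs -> convex_set (Q : set (convex_lmodType 'rV[R]_m)) ->
    (Q `&` \bigcup_n nrational n) t -> 0 < b < 1 ->
  exists r : 'rV[R]_m,
    [/\ forall i, (1 - b) * t 0 i <= r 0 i,
        forall s i, (Q `&` \bigcup_n nrational n) s -> r 0 i = 0 -> s 0 i = 0 &
        \forall n \near \oo, (Q `&` nrational n) !=set0 ->
          exists2 q, (Q `&` nrational n) q & forall i, r 0 i <= q 0 i].
Proof.
move=> Q_pmf Q_convex Tt /andP[b0 b1].
set T := Q `&` \bigcup_n nrational n.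
have Tpmf y : T y -> pmfs y by move=> [/Q_pmf].
have [X XT spanX] := exists_spanning_seq T.
pose Y := in_tuple (t :: X); set k := size (t :: X) in Y.
have YT y : y \in t :: X -> T y by rewrite inE => /predU1P[->//|/XT].
have spanY y : T y -> y \in <<Y>>%VS.
  move=> /spanX; apply: subvP; by rewrite /= span_cons addvSr.
have YTj (j : 'I_k) : T Y`_j by apply: YT; apply: mem_nth.
have k0 : 0 < k%:R :> R by rewrite ltr0n.
have [D D0 YD] := @common_denominator (t :: X) (fun y yY => (YT y yY).2).
have Dt i : D%:R * t 0 i \is a Num.nat by apply: YD; rewrite mem_head.
have DY (j : 'I_k) i : D%:R * Y`_j 0 i \is a Num.nat by apply: YD; apply: mem_nth.
pose c0 := b / 2 / k%:R.
have c00 : 0 < c0 by rewrite !divr_gt0.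
have sumc0 : \sum_(j < k) c0 = b / 2.
  by rewrite sumr_const card_ord -[c0 *+ k]mulr_natr /c0 divfK// gt_eqF.
pose r := (1 - b) *: t + \sum_(j < k) c0 *: Y`_j.
have rE i : r 0 i = (1 - b) * t 0 i + \sum_(j < k) c0 * Y`_j 0 i.
  by rewrite !mxE summxE; congr (_ + _); apply: eq_bigr => j _; rewrite mxE.
have sum_ge0 i : 0 <= \sum_(j < k) c0 * Y`_j 0 i.
  by apply: sumr_ge0 => j _; rewrite mulr_ge0 ?(ltW c00)// (Tpmf _ (YTj j)).1.
exists r; split.
- by move=> i; rewrite rE lerDl.
- move=> s i /spanY/coord_span -> r0.
  rewrite summxE big1// => j _; rewrite mxE.
  suff -> : Y`_j 0 i = 0 by rewrite mulr0.
  move: r0; rewrite rE => /eqP; rewrite paddr_eq0//; last first.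
    by rewrite mulr_ge0 ?(Tpmf _ Tt).1// subr_ge0 ltW.
  move=> /andP[_]; rewrite psumr_eq0; last first.
    by move=> j' _; rewrite mulr_ge0 ?(ltW c00)// (Tpmf _ (YTj j')).1.
  by move=> /allP/(_ j (mem_index_enum _))/=; rewrite mulf_eq0 gt_eqF//= => /eqP.
(* Coordinates of s relatively to the barycenter with weight 1 - b / 2 at t. *)
pose c s (j : 'I_k) : R := coord Y j (s - (1 - b / 2) *: t - \sum_(j < k) c0 *: Y`_j).
have cE s : T s ->
  s = (1 - b / 2) *: t + \sum_(j < k) c0 *: Y`_j + \sum_(j < k) c s j *: Y`_j.
  move=> Ts; rewrite -coord_span.
    by rewrite -[s - _ - _]addrA -opprD [RHS]addrC subrK.
  apply: rpredB; first by rewrite rpredB ?rpredZ ?spanY.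
  by apply: rpred_sum => j _; rewrite rpredZ// spanY.
(* Sources have mass 1, so these coordinates sum to 0. *)
have sum_c s : T s -> \sum_(j < k) c s j = 0.
  move=> Ts.
  have : \sum_i s 0 i = 1 by apply: (Tpmf _ Ts).2.
  rewrite {1}(cE s Ts); under eq_bigr do rewrite !mxE !summxE.
  rewrite !big_split/= -mulr_sumr (Tpmf _ Tt).2 mulr1.
  rewrite exchange_big/= (exchange_big _ _ _ _ _ (fun i j => (c s j *: Y`_j) 0 i))/=.
  have sumE (a : 'I_k -> R) : \sum_(j < k) \sum_i (a j *: Y`_j) 0 i = \sum_j a j.
    apply: eq_bigr => j _; under eq_bigr do rewrite mxE.
    by rewrite -mulr_sumr (Tpmf _ (YTj j)).2 mulr1.
  by rewrite !sumE sumc0 subrK => /eqP; rewrite -subr_eq0 [1 + _]addrC addrK => /eqP.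
near=> n => -[s [Qs ns]].
have n0 : (0 < n)%N by exact: nrational_gt0 ns.
have n0' : 0 < n%:R :> R by rewrite ltr0n.
have D0' : 0 < D%:R :> R by rewrite ltr0n.
have Ts : T s by split=> //; exists n.
pose e : R := D%:R / n%:R.
have e0 : 0 < e by rewrite divr_gt0.
(* Shifting each coordinate by an integer multiple z_j of e = D / n reduces it
   to a remainder th_j in [0, e]. *)
pose x (j : 'I_k) := c s j / e.
pose z (j : 'I_k) : int := - Num.floor (x j).
pose th (j : 'I_k) : R := e * (x j - (Num.floor (x j))%:~R).
have thE j : th j = c s j + (z j)%:~R * e.
  rewrite /th /z /x intrN; have := e0; move=> /gt_eqF/negbT e0'; field; exact: e0'.
have th_ge0 j : 0 <= th j.
  by rewrite mulr_ge0 ?(ltW e0)// subr_ge0 ge_floor.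
have th_le j : th j <= e.
  rewrite -[leRHS]mulr1 ler_wpM2l ?(ltW e0)// lerBlDl ltW//.
  by have /andP[_] := floor_itv (x j); rewrite intrD.
pose W := \sum_j (c0 + th j).
have WE : W = b / 2 + \sum_j th j by rewrite /W big_split/= sumc0.
have sumth0 : 0 <= \sum_j th j by exact: sumr_ge0.
have sumth_le : \sum_j th j <= b / 2.
  apply: (@le_trans _ _ (\sum_(j < k) e)); first exact: ler_sum.
  rewrite sumr_const card_ord -[e *+ k]mulr_natr /e.
  (* This is where n has to be large: the k errors must fit in the mass b / 2. *)
  have : (D * k)%:R / (b / 2) <= n%:R :> R by near: n; apply: nbhs_infty_ger.
  rewrite natrM !ler_pdivrMr ?divr_gt0//.
  rewrite [D%:R / _ * _]mulrAC [_ * (b / 2)]mulrC.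
  by rewrite ler_pdivrMr.
have W0 : 0 < W by rewrite WE ltr_wpDr// divr_gt0.
have W1 : W <= b by rewrite WE [leRHS](splitr b) lerD2l.
pose q := (1 - W) *: t + W *: (W^-1 *: \sum_j (c0 + th j) *: Y`_j).
have qE i : q 0 i = (1 - W) * t 0 i + \sum_j (c0 + th j) * Y`_j 0 i.
  rewrite /q scalerA divff ?gt_eqF// scale1r !mxE summxE; congr (_ + _).
  by apply: eq_bigr => j _; rewrite mxE.
have Qq : Q q.
  rewrite /q addrC; apply: convex_setP => //.
    by rewrite (ltW W0) (le_trans W1)// ltW.
    apply: convex_set_barycenter => //.
      by move=> j; rewrite addr_ge0// ltW.
    by move=> j; case: (YTj j).
  by case: Tt.
exists q; last first.
  move=> i; rewrite rE qE lerD//.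
    by rewrite ler_wpM2r ?(Tpmf _ Tt).1// lerB.
  by apply: ler_sum => j _; rewrite ler_wpM2r ?(Tpmf _ (YTj j)).1// lerDl.
split=> //; apply: (@nrational_shift n D k (fun j => Y`_j) z s t) => //.
- exact: Q_pmf.
rewrite {1}(cE s Ts) /q scalerA divff ?gt_eqF// scale1r.
rewrite -!addrA; under [X in _ = _ + (_ + (_ + X))]eq_bigr do rewrite scalerBr.
rewrite sumrB -scaler_suml.
have -> : \sum_j (z j)%:~R * (D%:R / n%:R) = \sum_j th j.
  by under [RHS]eq_bigr do rewrite thE; rewrite big_split/= sum_c// add0r.
under eq_bigr do rewrite scalerDl thE scalerDl.
rewrite !big_split/= WE opprD [1 + _]addrA scalerBl -!addrA.
by congr (_ + _); rewrite [LHS]addrC !addrA.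
Unshelve. all: by end_near. Qed.

End RationalPoints.

(** * The exponential of the L-divergence *)

Section LikelihoodRate.
Context {R : realType} {m : nat}.
Implicit Types (p q r s nu : 'rV[R]_m) (Q : set 'rV[R]_m) (n : nat).

(** exp L(q || p).  The conventions 0 ^ 0 = 1 and 0 ^ x = 0 for x <> 0 of powR
are those of the L-divergence, and a product avoids infinite values. *)
Definition Lexp p q : R := \prod_i q 0 i `^ p 0 i.

Lemma Lexp_ge0 p q : 0 <= Lexp p q.
Proof. by apply: prodr_ge0 => i _; exact: powR_ge0. Qed.

Lemma Lexp_le1 p q : pmfs p -> pmfs q -> Lexp p q <= 1.
Proof.
move=> [p0 _] q_pmf; rewrite /Lexp; apply: prodr_ile1 => i _; rewrite powR_ge0/=.
have -> : 1 = 1 `^ p 0 i :> R by rewrite powR1.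
by rewrite ge0_ler_powR ?nnegrE ?q_pmf.1 ?pmf_le1.
Qed.

Lemma lneM_ge0 (x y : R) : 0 <= x -> 0 <= y ->
  lne (x * y)%:E = (lne x%:E + lne y%:E)%E.
Proof.
rewrite le_eqVlt => /predU1P[<- y0|x0].
  by rewrite mul0r !(@le0_lneNy _ 0%:E)// addNye.
rewrite le_eqVlt => /predU1P[<-|y0].
  by rewrite mulr0 !(@le0_lneNy _ 0%:E)// lne_EFin.
by rewrite !lne_EFin ?mulr_gt0// lnM.
Qed.

Lemma lne_powR (a x : R) : 0 <= a -> 0 <= x ->
  (a%:E * lne x%:E)%E = lne (x `^ a)%:E.
Proof.
move=> a0; rewrite le_eqVlt => /predU1P[<-|x0]; last first.
  by rewrite !lne_EFin ?powR_gt0// ln_powR.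
rewrite [lne 0%:E]le0_lneNy//.
have [->|a_neq0] := eqVneq a 0; first by rewrite mul0e powRr0 lne1.
rewrite powR0// le0_lneNy//; apply/gt0_muleNy.
by rewrite lte_fin lt_def a_neq0.
Qed.

Lemma LdivE p q : pmfs p -> pmfs q -> Ldiv q p = lne (Lexp p q)%:E.
Proof.
move=> [p0 _] [q0 _]; rewrite /Ldiv /Lexp.
suff [] : 0 <= \prod_i q 0 i `^ p 0 i /\
  (\sum_i (p 0 i)%:E * lne (q 0 i)%:E)%E = lne (\prod_i q 0 i `^ p 0 i)%:E by [].
apply: (big_ind2 (fun (x : R) (y : \bar R) => 0 <= x /\ y = lne x%:E)).
- by rewrite lne1.
- by move=> x a y b' [x0 ->] [y0 ->]; rewrite mulr_ge0// lneM_ge0.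
- by move=> i _; rewrite powR_ge0 lne_powR.
Qed.

(** As lne is increasing on nonnegative numbers, a source of Q at which Lexp p is
no smaller than at qhat is an L-projection too. *)
Lemma Lprojection_max p Q qhat : pmfs p -> Q `<=` pmfs ->
    Lprojections p Q = [set qhat] ->
  Q qhat /\ forall q, Q q -> q != qhat -> Lexp p q < Lexp p qhat.
Proof.
move=> p_pmf Q_pmf proj.
have [Qqhat supL] : Lprojections p Q qhat by rewrite proj.
split=> // q Qq; apply: contraNT; rewrite -leNgt => qhat_le.
suff : Lprojections p Q q by rewrite proj => /= ->.
split=> //; rewrite -supL; apply/eqP; rewrite eq_le; apply/andP; split.
  by rewrite supL; apply: ereal_sup_ubound; exists q.
rewrite !LdivE//; try exact: Q_pmf.
by rewrite lee_lne ?lee_fin// in_itv/= lee_fin Lexp_ge0 leey.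
Qed.

(** The p_i sum to 1, so that b is the product of the b ^ p_i.  This lemma stands in
for the lower semicontinuity of Lexp p, at points with zero coordinates as well. *)
Lemma Lexp_ge_scale p q r (b : R) : pmfs p -> 0 <= b -> (forall i, 0 <= q 0 i) ->
  (forall i, b * q 0 i <= r 0 i) -> b * Lexp p q <= Lexp p r.
Proof.
move=> [p0 p1] b0 q0 qr.
have -> : b = \prod_i b `^ p 0 i.
  rewrite -[LHS]powRr1// -[in LHS]p1; suff [] : 0 <= \sum_i p 0 i /\
    b `^ (\sum_i p 0 i) = \prod_i b `^ p 0 i by [].
  apply: (big_ind2 (fun x y : R => 0 <= x /\ b `^ x = y)) => //.
  - by rewrite powRr0.
  - move=> x a y b' [x0 <-] [y0 <-]; rewrite addr_ge0//; split=> //.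
    have [->|x_neq0] := eqVneq x 0; first by rewrite add0r powRr0 mul1r.
    by rewrite powRD// gt_eqF// ltr_wpDr// lt_def x_neq0.
rewrite /Lexp -big_split/=; apply: ler_prod => i _.
rewrite mulr_ge0 ?powR_ge0//= -powRM//.
by rewrite ge0_ler_powR ?nnegrE ?mulr_ge0// (le_trans _ (qr i))// mulr_ge0.
Qed.

(** Since q_i <= 1, the power q_i ^ x decreases with x; the case q_i = 0 is
consistent because th p_i vanishes when nu_i does. *)
Lemma Lexp_le_powR p nu q (th : R) : pmfs q -> (forall i, 0 <= p 0 i) -> 0 < th ->
    (forall i, 0 <= nu 0 i) -> (forall i, th * p 0 i <= nu 0 i) ->
  Lexp nu q <= Lexp p q `^ th.
Proof.
move=> q_pmf p0 th0 nu0 thp.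
have -> : Lexp p q `^ th = \prod_i q 0 i `^ (th * p 0 i).
  rewrite /Lexp; suff [] : 0 <= \prod_i q 0 i `^ p 0 i /\ 
    (\prod_i q 0 i `^ p 0 i) `^ th = \prod_i q 0 i `^ (th * p 0 i) by [].
  apply: (big_ind2 (fun x y : R => 0 <= x /\ x `^ th = y)).
  - by rewrite powR1.
  - by move=> x a y b' [x0 <-] [y0 <-]; rewrite mulr_ge0// powRM.
  - by move=> i _; rewrite powR_ge0 -powRrM mulrC.
apply: ler_prod => i _; rewrite powR_ge0/=.
have := q_pmf.1 i; rewrite le_eqVlt => /predU1P[q0|q_gt0].
  rewrite -q0; have [nui0|nui_neq0] := eqVneq (nu 0 i) 0.
    have -> : th * p 0 i = 0.
      by apply/eqP; rewrite eq_le mulr_ge0 ?(ltW th0)// andbT -{1}nui0.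
    by rewrite nui0.
  by rewrite powR0// powR_ge0.
by apply: ger_powR => //; rewrite q_gt0 pmf_le1.
Qed.

(** The absolute value gives a function that is continuous on the whole line: powR is
equal to 1 at negative reals. *)
Lemma continuous_normr_powR (a : R) : 0 <= a -> continuous (fun x : R => `|x| `^ a).
Proof.
rewrite le_eqVlt => /predU1P[<-|a0].
  by under eq_fun do rewrite powRr0; move=> x; exact: cvg_cst.
move=> x; have [->|x_neq0] := eqVneq x 0.
  rewrite /continuous_at normr0 powR0 ?gt_eqF//; apply/cvgr0Pnorm_lt => e e0.
  near=> y.
  rewrite ger0_norm ?powR_ge0//.
  have -> : e = (e `^ a^-1) `^ a by rewrite -powRrM mulVf ?gt_eqF// powRr1 ?ltW.
  apply: gt0_ltr_powR; rewrite ?nnegrE ?powR_ge0//.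
  near: y; apply: (@nbhs0_lt _ R^o); exact: powR_gt0.
have x0 : 0 < `|x| by rewrite normr_gt0.
apply: (@continuous_comp _ _ _ (fun y : R => `|y|) (fun y => y `^ a)).
  exact: norm_continuous.
apply: differentiable_continuous; apply/derivable1_diffP.
by have := @derivable_powR R 1 a `|x|; apply; rewrite in_itv/= x0.
Unshelve. all: by end_near. Qed.

(** F is compact, so Lexp p attains its maximum on it.  The comparison with
g / 2 makes u positive. *)
Lemma Lexp_sup_lt p (F : set 'rV[R]_m) (g : R) :
    pmfs p -> closed F -> F `<=` pmfs -> 0 < g ->
    (forall q, F q -> Lexp p q < g) ->
  exists2 u, 0 < u < g & forall q, F q -> Lexp p q <= u.
Proof.
move=> p_pmf clF F_pmf g0 Fg.
have [->|F0] := eqVneq F set0; first by exists (g / 2) => //; lra.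
have cF : compact F.
  apply: subclosed_compact clF (rV_compact (fun _ : 'I_m => @segment_compact R 0 1)) _.
  by move=> q /F_pmf q_pmf i; rewrite /= in_itv/= q_pmf.1 pmf_le1.
pose f (q : 'rV[R]_m) : R := \prod_i `|q 0 i| `^ p 0 i.
have fE q : F q -> f q = Lexp p q.
  by move=> /F_pmf[q0 _]; apply: eq_bigr => i _; rewrite ger0_norm.
have fc : continuous f.
  apply: continuous_big; first exact: mul_continuous.
  move=> i _ x.
  apply: (@continuous_comp _ _ _ (fun y : 'rV[R]_m => y 0 i)
    (fun y : R => `|y| `^ p 0 i)).
    exact: coord_continuous.
  by apply: continuous_normr_powR; exact: p_pmf.1.
have [||c cF' cmax] := @EVT_max_rV _ _ f F _ cF; first exact/set0P.
  exact: continuous_subspaceT.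
rewrite inE in cF'.
exists (Num.max (Lexp p c) (g / 2)).
  by rewrite lt_max gt_max Fg//; apply/and3P; split=> //; [apply/orP; right|]; lra.
by move=> q Fq; rewrite le_max -!fE// cmax ?inE.
Qed.

End LikelihoodRate.

(** * Sums over few points and geometric decay *)

Lemma fsum_le_card {R : realDomainType} {I : finType} {T : choiceType} (g : I -> T)
    (A : set T) (f : T -> R) (c : R) :
    A `<=` range g -> (forall x, A x -> f x <= c) -> 0 <= c ->
  \sum_(x \in A) f x <= #|I|%:R * c.
Proof.
move=> Ag fc c0.
have finA : finite_set A.
  by apply: (sub_finite_set Ag); apply: finite_image; exact: finite_finset.
rewrite fsbig_finite//=.
apply: (@le_trans _ _ (\sum_(x <- finmap.enum_fset (fset_set A)) c)).
  rewrite big_seq [leRHS]big_seq; apply: ler_sum => x.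
  by rewrite in_fset_set// inE => /fc.
rewrite big_const_seq count_predT iter_addr_0 -[leLHS]mulr_natl ler_wpM2r// ler_nat.
rewrite cardE -(size_map g); apply: uniq_leq_size; first exact: finmap.fset_uniq.
by move=> x; rewrite in_fset_set// inE => /Ag[i _ <-]; rewrite map_f// mem_enum.
Qed.

(** With rho = exp (- c) and N = n + 1, the term of degree m + 1 of the
exponential series gives exp (c N) >= (c N) ^ (m + 1) / (m + 1)!, so the sequence is O(1 / N). *)
Lemma cvg_expn_geometric {R : realType} (m : nat) (rho : R) : 0 < rho < 1 ->
  (n.+1)%:R ^+ m * rho ^+ n @[n --> \oo] --> (0 : R).
Proof.
move=> /andP[rho0 rho1].
pose c := - ln rho; have c0 : 0 < c by rewrite oppr_gt0 ln_lt0// rho0.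
have rhoE : rho = expR (- c) by rewrite opprK lnK.
pose C := rho^-1 * (m.+1)`!%:R / c ^+ m.+1.
apply: (@squeeze_cvgr _ _ _ _ (fun=> 0) (fun n => C * harmonic n)).
- apply: nearW => n; rewrite mulr_ge0 ?exprn_ge0 ?(ltW rho0)//=.
  have cn0 : 0 < c * n.+1%:R by rewrite mulr_gt0.
  have f0 : 0 < (m.+1)`!%:R :> R by rewrite ltr0n fact_gt0.
  have : (c * n.+1%:R) ^+ m.+1 / (m.+1)`!%:R <= rho ^- n.+1.
    have -> : rho ^- n.+1 = expR (c * n.+1%:R).
      by rewrite rhoE expRN exprVn invrK mulrC expRM_natl.
    by apply: le_trans (expR_ge1Dxn m (ltW cn0)); rewrite lerDr ler01.
  rewrite ler_pdivrMr// ler_pdivlMl ?exprn_gt0// => h.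
  rewrite /C /harmonic /= -(ler_pM2r (_ : 0 < rho * c ^+ m.+1 * n.+1%:R)); last first.
    by rewrite !mulr_gt0// exprn_gt0.
  have -> : n.+1%:R ^+ m * rho ^+ n * (rho * c ^+ m.+1 * n.+1%:R) =
      rho ^+ n.+1 * (c * n.+1%:R) ^+ m.+1.
    by rewrite exprMn !exprS; ring.
  apply: (le_trans h); rewrite le_eqVlt; apply/orP; left; apply/eqP; field.
  by rewrite expf_neq0 ?gt_eqF.
- exact: cvg_cst.
- rewrite -[X in _ --> X](mulr0 C); apply: cvgMl_tmp; exact: cvg_harmonic.
Qed.

(** * Posterior probabilities *)

Section Posterior.
Context {R : realType} {m : nat}.
Implicit Types (p q r s nu t : 'rV[R]_m) (Q B : set 'rV[R]_m) (n : nat).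

Lemma nrational_range n :
  nrational n `<=` range (fun k : {ffun 'I_m -> 'I_n.+1} =>
    (\row_i ((k i)%:R / n%:R) : 'rV[R]_m)).
Proof.
move=> q [_ [k [sumk kq]]].
have kn i : (k i < n.+1)%N by rewrite ltnS -sumk (bigD1 i)//= leq_addr.
exists [ffun i => Ordinal (kn i)] => //.
by apply/rowP => i; rewrite mxE ffunE kq.
Qed.

Lemma finite_nrational n : finite_set (@nrational R m n).
Proof.
apply: (sub_finite_set (@nrational_range n)); apply: finite_image.
exact: finite_finset.
Qed.

Definition multinomial n nu : R := n`!%:R / (\prod_i (Defs.count n nu i)`!)%:R.

Lemma multinomial_gt0 n nu : 0 < multinomial n nu.
Proof.
by rewrite divr_gt0// ltr0n ?fact_gt0// prodn_gt0// => i; exact: fact_gt0.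
Qed.

Lemma countE n nu i : nrational n nu -> (Defs.count n nu i)%:R = n%:R * nu 0 i.
Proof. by move=> /nrationalP[_ _ h]; rewrite /Defs.count truncnK. Qed.

Lemma likelihoodE n nu q : nrational n nu -> (forall i, 0 <= q 0 i) ->
  likelihood n nu q = multinomial n nu * Lexp nu q ^+ n.
Proof.
move=> n_nu q0; rewrite /likelihood /Lexp -prodrXl; congr (_ * _).
apply: eq_bigr => i _.
by rewrite -powR_mulrn// countE// mulrC powRrM powR_mulrn ?powR_ge0.
Qed.

Lemma likelihood_ge0 n nu q : (forall i, 0 <= q 0 i) -> 0 <= likelihood n nu q.
Proof.
move=> q0; apply: mulr_ge0; first exact: ltW (multinomial_gt0 n nu).
by apply: prodr_ge0 => i _; rewrite exprn_ge0.
Qed.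

(** The prior is uniform, so the posterior is proportional to the likelihood. *)
Lemma posteriorE n nu : exists2 w : R, 0 <= w &
  forall q, posterior n nu q = likelihood n nu q * w.
Proof.
pose Z := \sum_(r \in nrational n) (likelihood n nu r * prior n r).
exists (('C(n + m - 1, m - 1))%:R^-1 / Z); last by move=> q; rewrite /posterior mulrA.
rewrite divr_ge0 ?invr_ge0//; apply: fsumr_ge0 => r [r_pmf _].
by rewrite mulr_ge0 ?invr_ge0// likelihood_ge0//; exact: r_pmf.1.
Qed.

Lemma posterior_ge0 n nu q : pmfs q -> 0 <= posterior n nu q.
Proof.
by move=> [q0 _]; have [w w0 ->] := posteriorE n nu; rewrite mulr_ge0// likelihood_ge0.
Qed.

(** Some n-source s of Q has a positive likelihood, so it charges every letter that
nu charges. *)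
Lemma posterior_set_gt0 n nu Q : nrational n nu -> 0 < posterior_set n nu Q ->
  exists2 s, (Q `&` nrational n) s & forall i, s 0 i = 0 -> nu 0 i = 0.
Proof.
move=> n_nu; rewrite lt_def => /andP[/eqP pQ _].
have [s [QRs /eqP ps]] : exists s, (Q `&` nrational n) s /\ posterior n nu s <> 0.
  apply: contrapT => h; apply: pQ; apply: fsbig1 => s Qs.
  by apply: contrapT => ps; apply: h; exists s.
exists s => // i si; move: ps; apply: contraNeq => nui.
have cnt_neq0 : (Defs.count n nu i == 0)%N = false.
  apply/negbTE; rewrite -(eqr_nat R) countE// mulf_neq0// pnatr_eq0 -lt0n.
  exact: nrational_gt0 n_nu.
have prod0 : \prod_j s 0 j ^+ Defs.count n nu j = 0.
  by rewrite (bigD1 i)//= si expr0n cnt_neq0 mul0r.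
by rewrite /posterior /likelihood prod0 mulr0 !mul0r.
Qed.

Lemma cond_posterior_sub n nu Q B : Q `<=` B -> 0 < posterior_set n nu Q ->
  cond_posterior n nu B Q = 1.
Proof.
by move=> QB pQ; rewrite /cond_posterior (setIidr QB) divff// gt_eqF.
Qed.

(** Each of the at most (n + 1) ^ m sources of Q outside B has, up to a common factor,
posterior at most g3 ^ n, and Q has a source with posterior at least g2 ^ n. *)
Lemma cond_posterior_bounds n nu Q B (g3 g2 : R) :
    nrational n nu -> 0 < posterior_set n nu Q -> 0 <= g3 -> 0 < g2 ->
    (forall q, (Q `&` nrational n) q -> ~ B q -> Lexp nu q <= g3) ->
    (exists2 q, (Q `&` nrational n) q & g2 <= Lexp nu q) ->
  1 - n.+1%:R ^+ m * (g3 / g2) ^+ n <= cond_posterior n nu B Q <= 1.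
Proof.
move=> n_nu pQ g30 g20 up [q0 QRq0 lo].
set A := Q `&` nrational n.
have finA : finite_set A by apply: sub_finite_set (@finite_nrational n) => q [].
have A0 q : A q -> 0 <= posterior n nu q by move=> [_ [q_pmf _]]; exact: posterior_ge0.
pose pB := posterior_set n nu (B `&` Q).
pose pC := \sum_(q \in A `&` ~` B) posterior n nu q.
have pQE : posterior_set n nu Q = pB + pC.
  rewrite [LHS](fsbigID B)//; congr (_ + _).
  by rewrite /pB /posterior_set -setIA [A `&` B]setIC.
rewrite /cond_posterior -/pB.
have pC0 : 0 <= pC by apply: fsumr_ge0 => q [/A0].
have [w w0 wE] := posteriorE n nu.
set M := multinomial n nu; have M0 : 0 < M by exact: multinomial_gt0.
have postE q : A q -> posterior n nu q = M * Lexp nu q ^+ n * w.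
  by move=> [_ [[q_ge0 _] _]]; rewrite wE likelihoodE.
have pC_le : pC <= n.+1%:R ^+ m * (M * g3 ^+ n * w).
  have -> : n.+1%:R ^+ m = #|{ffun 'I_m -> 'I_n.+1}|%:R :> R.
    by rewrite card_ffun !card_ord natrX.
  apply: (@fsum_le_card _ _ _ (fun k : {ffun 'I_m -> 'I_n.+1} =>
    (\row_i ((k i)%:R / n%:R) : 'rV[R]_m))).
  - by move=> q [[_ /nrational_range]].
  - move=> q [Aq nBq]; rewrite postE// ler_wpM2r// ler_pM2l//.
    by rewrite lerXn2r ?nnegrE ?Lexp_ge0// up.
  - by rewrite !mulr_ge0 ?exprn_ge0// ltW.
have pQ_ge : M * g2 ^+ n * w <= posterior_set n nu Q.
  apply: (@le_trans _ _ (posterior n nu q0)).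
    rewrite postE// ler_wpM2r// ler_pM2l//.
    by rewrite lerXn2r ?nnegrE ?Lexp_ge0// ltW.
  rewrite /posterior_set -/A (fsbigD1 q0)//= lerDl; apply: fsumr_ge0 => q [Aq _].
  exact: A0.
apply/andP; split; last by rewrite ler_pdivrMr// mul1r pQE lerDl.
rewrite ler_pdivlMr// mulrBl mul1r lerBlDr {1}pQE lerD2l.
apply: (le_trans pC_le); rewrite -[leRHS]mulrA ler_wpM2l ?exprn_ge0//.
have -> : M * g3 ^+ n * w = (g3 / g2) ^+ n * (M * g2 ^+ n * w).
  by rewrite expr_div_n; have := exprn_gt0 n g20 => /gt_eqF/negbT h; field.
by rewrite ler_wpM2l// exprn_ge0// divr_ge0// ltW.
Qed.

End Posterior.

(** * Total variation *)

Section TotalVariation.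
Context {R : realType} {m : nat}.
Implicit Types (p q : 'rV[R]_m).

Lemma tv_refl q : tv q q = 0.
Proof. by rewrite /tv big1 ?mulr0// => i _; rewrite subrr normr0. Qed.

Lemma tv_coord_le p q i : `|p 0 i - q 0 i| <= 2 * tv p q.
Proof.
rewrite /tv mulrA divff ?mul1r ?pnatr_eq0//.
by rewrite (bigD1 i)//= lerDl sumr_ge0.
Qed.

Lemma tv_continuous q : continuous (tv q).
Proof.
have sum_continuous : continuous (fun x : 'rV[R]_m => \sum_i `|q 0 i - x 0 i|).
  apply: continuous_big; first exact: add_continuous.
  move=> i _ x; have x_cvg := @coord_continuous _ _ _ 0 i x.
  exact: cvg_norm (cvgB (cvg_cst (q 0 i)) x_cvg).
move=> x; exact: cvgMl_tmp (sum_continuous x).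
Qed.

Lemma tv_cvg_coord (nu : nat -> 'rV[R]_m) p i :
  tv (nu n) p @[n --> \oo] --> (0 : R) -> nu n 0 i @[n --> \oo] --> p 0 i.
Proof.
move=> nu_p; apply/subr_cvg0; apply/norm_cvg0P.
apply: (@squeeze_cvgr _ _ _ _ (fun=> 0) (fun n => 2 * tv (nu n) p)).
- by apply: nearW => n; rewrite normr_ge0 tv_coord_le.
- exact: cvg_cst.
- by rewrite -[X in _ --> X](mulr0 2); apply: cvgMl_tmp.
Qed.

End TotalVariation.

(** * Exponential rates of the likelihood *)

Section Rates.
Context {R : realType} {m : nat}.
Context (p : 'rV[R]_m) (nu : nat -> 'rV[R]_m)
  (p_pmf : pmfs p) (nu_type : forall n, (0 < n)%N -> nrational n (nu n))
  (nu_cvg : tv (nu n) p @[n --> \oo] --> (0 : R)).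
Implicit Types (q r s t : 'rV[R]_m) (Q : set 'rV[R]_m) (n : nat).

(** The exponent th = ln g3 / ln u lies in ]0, 1[ and satisfies u ^ th = g3; for n
large, nu^n >= th p coordinatewise. *)
Lemma Lexp_upper_rate (u g3 : R) : 0 < u -> u < g3 -> g3 < 1 ->
  \forall n \near \oo, forall q, pmfs q -> Lexp p q <= u -> Lexp (nu n) q <= g3.
Proof.
move=> u0 ug3 g31.
have g30 : 0 < g3 by exact: lt_trans ug3.
have u1 : u < 1 by exact: lt_trans g31.
have lnu : ln u < 0 by rewrite ln_lt0// u0.
have lng3 : ln g3 < 0 by rewrite ln_lt0// g30.
pose th := ln g3 / ln u.
have th0 : 0 < th by rewrite nmulr_rgt0// invr_lt0.
have th1 : th < 1 by rewrite ltr_ndivrMr// mul1r ltr_ln.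
have uth : u `^ th = g3.
  by rewrite /powR gt_eqF// /th divfK ?lt_eqF// lnK.
have nu_ge : \forall n \near \oo, forall i, th * p 0 i <= nu n 0 i.
  apply: filter_forall => i.
  have := p_pmf.1 i; rewrite le_eqVlt => /predU1P[p0|pi0].
    near=> n; rewrite -p0 mulr0.
    have n0 : (0 < n)%N by near: n; exact: nbhs_infty_gt.
    by have [[h _] _] := nu_type n0; exact: h.
  have lt_p : th * p 0 i < p 0 i by rewrite gtr_pMl.
  near=> n; apply: ltW; near: n.
  exact: (cvgr_gt _ (tv_cvg_coord (i := i) nu_cvg) _ lt_p).
near=> n => q q_pmf qu.
have n0 : (0 < n)%N by near: n; exact: nbhs_infty_gt.
have [[nun0 _] _] := nu_type n0.
apply: (@le_trans _ _ (Lexp p q `^ th)).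
  apply: Lexp_le_powR => //; first exact: p_pmf.1.
  by near: n.
by rewrite -uth ge0_ler_powR ?nnegrE ?Lexp_ge0// ltW.
Unshelve. all: by end_near. Qed.

(** A coordinate where qhat vanishes imposes nothing; each other one is an open
condition at qhat. *)
Lemma rational_approx Q qhat (b : R) : Q `<=` pmfs -> Q qhat -> 0 < b ->
    closure (Q `&` \bigcup_n nrational n) qhat ->
  exists2 t, (Q `&` \bigcup_n nrational n) t &
    forall i, (1 - b) * qhat 0 i <= t 0 i.
Proof.
move=> Q_pmf Qq b0 clq.
have : \forall t \near qhat, forall i,
    qhat 0 i = 0 \/ (1 - b) * qhat 0 i < (t : 'rV[R]_m) 0 i.
  apply: (@filter_forall _ _ (fun i (t : 'rV[R]_m) =>
    qhat 0 i = 0 \/ (1 - b) * qhat 0 i < t 0 i) _ (nbhs_filter qhat)) => i.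
  have := (Q_pmf _ Qq).1 i; rewrite le_eqVlt => /predU1P[q0|qi0].
    by apply: nearW => t; left.
  have lt_q : (1 - b) * qhat 0 i < qhat 0 i by rewrite gtr_pMl// gtrBl.
  near=> t; right; near: t.
  exact: (cvgr_gt _ (@coord_continuous _ _ _ 0 i qhat) _ lt_q).
move=> /clq[t [Tt tq]]; exists t => // i.
case: (tq i) => [->|/ltW//]; rewrite mulr0.
by case: Tt => /Q_pmf[t0 _] _.
Unshelve. all: by end_near. Qed.

(** The exponents nu^n_i vary with n, and x ^ y is continuous in y only for x > 0.  The
letters with r_i = 0 have nu^n_i = 0 whenever the conditional is defined, so r_i can be
replaced there by 1 without changing the product. *)
Lemma Lexp_lower_rate Q t (b g2 : R) :
    Q `<=` pmfs -> convex_set (Q : set (convex_lmodType 'rV[R]_m)) ->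
    (Q `&` \bigcup_n nrational n) t -> 0 < b < 1 -> 0 < g2 ->
    g2 < (1 - b) * Lexp p t ->
  \forall n \near \oo, 0 < posterior_set n (nu n) Q ->
    exists2 q, (Q `&` nrational n) q & g2 <= Lexp (nu n) q.
Proof.
move=> Q_pmf Q_convex Tt b01 g20 g2t.
have [r [tr r0 rq]] := nrational_approx Q_pmf Q_convex Tt b01.
have /andP[b0 b1] := b01.
have t_ge0 i : 0 <= t 0 i by case: Tt => /Q_pmf[].
have r_ge0 i : 0 <= r 0 i by apply: le_trans (tr i); rewrite mulr_ge0// subr_ge0 ltW.
have g2r : g2 < Lexp p r.
  by apply: (lt_le_trans g2t); apply: Lexp_ge_scale => //; rewrite subr_ge0 ltW.
pose r' i : R := if r 0 i == 0 then 1 else r 0 i.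
have r'_gt0 i : 0 < r' i by rewrite /r'; case: eqVneq => // ri; rewrite lt_def ri/=.
have LexpE (p' : 'rV[R]_m) : (forall i, r 0 i = 0 -> p' 0 i = 0) ->
    Lexp p' r = \prod_i r' i `^ p' 0 i.
  move=> h; apply: eq_bigr => i _; rewrite /r'; case: eqVneq => // ri.
  by rewrite h// !powRr0.
have cvg_r' : \prod_i r' i `^ nu n 0 i @[n --> \oo] --> Lexp p r.
  rewrite LexpE; last first.
    move=> i ri; apply: contraTeq g2r => pi.
    rewrite -leNgt /Lexp (bigD1 i)//= ri powR0// mul0r ltW//.
  apply: cvg_big; first exact: mul_continuous.
  move=> i _.
  rewrite /powR gt_eqF//; apply: continuous_cvg; first exact: continuous_expR.
  by apply: cvgMr_tmp; exact: tv_cvg_coord.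
near=> n => pQ.
have n0 : (0 < n)%N by near: n; exact: nbhs_infty_gt.
have [s Qs s0] := posterior_set_gt0 (nu_type n0) pQ.
have [q Qq qr] : exists2 q, (Q `&` nrational n) q & forall i, r 0 i <= q 0 i.
  by have : (Q `&` nrational n) !=set0 by [exists s]; near: n.
exists q => //.
apply: (@le_trans _ _ (Lexp (nu n) r)); last first.
  rewrite -[leLHS]mul1r; apply: Lexp_ge_scale => //; last by move=> i; rewrite mul1r.
  by case: (nu_type n0).
rewrite LexpE.
  by apply: ltW; near: n; exact: (cvgr_gt _ cvg_r' _ g2r).
move=> i ri; apply: s0; apply: (r0 s) => //.
by case: Qs => Qs ns; split=> //; exists n.
Unshelve. all: by end_near. Qed.

End Rates.

Unset Implicit Arguments.
Set Strict Implicit.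

Theorem mainTheorem7 (R : realType) (m : nat) (p : 'rV[R]_m)
    (nu : nat -> 'rV[R]_m) (Q : set 'rV[R]_m) (qhat : 'rV[R]_m)
    (p_pmf : pmfs p)
    (nu_type : forall n, (0 < n)%N -> nrational n (nu n))
    (nu_cvg : tv (nu n) p @[n --> \oo] --> (0 : R))
    (Q_pmf : Q `<=` pmfs)
    (Q_convex : convex_set (Q : set (convex_lmodType 'rV[R]_m)))
    (Q_closed : closed Q)
    (Q_rare : ~ Q p)
    (* qhat is the (unique) L-projection of p on Q *)
    (qhat_proj : Lprojections p Q = [set qhat])
    (* qhat is a limit of n-sources belonging to Q *)
    (qhat_reach : closure (Q `&` \bigcup_n nrational n) qhat) :
  forall eps : R, 0 < eps ->
    (* the limit is taken along the n for which the conditional is defined *)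
    cond_posterior n (nu n) (tv_ball qhat eps) Q
      @[n --> within [set n | 0 < posterior_set n (nu n) Q] \oo] --> (1 : R).
Proof.
move=> eps eps0.
have [Qqhat qhat_max] := Lprojection_max p_pmf Q_pmf qhat_proj.
set S := [set n | _].
have far_neq q : eps <= tv qhat q -> q != qhat.
  by apply: contraTneq => ->; rewrite tv_refl -ltNge.
have [g0_eq0|g0_neq0] := eqVneq (Lexp p qhat) 0.
  have QB : Q `<=` tv_ball qhat eps.
    move=> q Qq; have [->|/(qhat_max _ Qq)] := eqVneq q qhat.
      by split; [exact: Q_pmf|rewrite tv_refl ltW].
    by rewrite g0_eq0 ltNge Lexp_ge0.
  apply: (@cvg_trans _ ((1 : R) @[n --> within S \oo])); last exact: cvg_cst.
  apply: near_eq_cvg; rewrite near_withinE; apply: nearW => n Sn.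
  by rewrite cond_posterior_sub.
have g00 : 0 < Lexp p qhat by rewrite lt_def g0_neq0 Lexp_ge0.
set g0 := Lexp p qhat in qhat_max g0_neq0 g00.
pose F := Q `&` [set q | eps <= tv qhat q].
have F_closed : closed F.
  apply: closedI => //; apply: (@preimage_closed _ _ (tv qhat) [set x | eps <= x]).
    by move=> x _; exact: tv_continuous.
  exact: closed_ge.
have F_pmf : F `<=` pmfs by move=> q [/Q_pmf].
have F_lt q : F q -> Lexp p q < g0 by move=> [Qq /far_neq]; exact: qhat_max.
have [u /andP[u0 ug0] Fu] := Lexp_sup_lt p_pmf F_closed F_pmf g00 F_lt.
have g01 : g0 <= 1 by apply: Lexp_le1 => //; exact: Q_pmf.
(* The interval from u to g0 is cut in three. *)
pose g3 := (2 * u + g0) / 3; pose g2 := (u + 2 * g0) / 3.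
have [ug3 g3g2 g2g0] : [/\ u < g3, g3 < g2 & g2 < g0].
  by rewrite /g3 /g2; split; lra.
have g30 : 0 < g3 by exact: lt_trans ug3.
have g20 : 0 < g2 by exact: lt_trans g3g2.
(* The loss (1 - b) is incurred twice, from qhat to t and from t to an n-source of
   Q; this b ensures (1 - b) ^ 2 g0 > g2. *)
pose b := (g0 - g2) / (2 * g0) / 2.
have bE : b * g0 = (g0 - g2) / 4 by rewrite /b; field.
have b0 : 0 < b by rewrite !divr_gt0 ?subr_gt0// mulr_gt0.
have b1 : b < 1 by rewrite -(ltr_pM2r g00) bE; lra.
have [t Tt tqhat] := rational_approx Q_pmf Qqhat b0 qhat_reach.
have g2t : g2 < (1 - b) * Lexp p t.
  have : (1 - b) * g0 <= Lexp p t.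
    by apply: Lexp_ge_scale => //; [rewrite subr_ge0 ltW|exact: (Q_pmf _ Qqhat).1].
  rewrite -(ler_pM2l (_ : 0 < 1 - b)) ?subr_gt0//; apply: lt_le_trans.
  have -> : (1 - b) * ((1 - b) * g0) = g0 - 2 * (b * g0) + b * b * g0 by ring.
  have : 0 < b * b * g0 := mulr_gt0 (mulr_gt0 b0 b0) g00.
  by rewrite bE; lra.
have g31 : g3 < 1 by exact: lt_le_trans (lt_trans g3g2 g2g0) g01.
have upper := Lexp_upper_rate p_pmf nu_type nu_cvg u0 ug3 g31.
have b01 : 0 < b < 1 by rewrite b0.
have lower := Lexp_lower_rate p_pmf nu_type nu_cvg Q_pmf Q_convex Tt b01 g20 g2t.
have bounds : \forall n \near within S \oo,
    1 - n.+1%:R ^+ m * (g3 / g2) ^+ n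
      <= cond_posterior n (nu n) (tv_ball qhat eps) Q <= 1.
  rewrite near_withinE; near=> n => Sn.
  have n0 : (0 < n)%N by near: n; exact: nbhs_infty_gt.
  apply: cond_posterior_bounds => //; [exact: nu_type|exact: ltW| |].
    move=> q [Qq _] qB.
    have up : forall q, pmfs q -> Lexp p q <= u -> Lexp (nu n) q <= g3 by near: n.
    apply: up; [exact: Q_pmf|apply: Fu; split=> //=].
    rewrite leNgt; apply/negP => /ltW qe; apply: qB; split=> //; exact: Q_pmf.
  by move: Sn; near: n.
apply: (squeeze_cvgr bounds); last exact: cvg_cst.
apply: (cvg_trans (cvg_app _ (@cvg_within _ _ _ S))).
rewrite -[X in _ --> X](subr0 1); apply: cvgB; first exact: cvg_cst.
apply: cvg_expn_geometric; rewrite divr_gt0//= ltr_pdivrMr// mul1r//.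
Unshelve. all: by end_near. Qed.
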